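(* Let $H$ be a complex Hilbert space with $\dim H\ge 2$. Define $\delta:[0,1)\to[0,\infty)$ by $$\delta(\varepsilon)=\frac{1-\sqrt{\frac{1-\varepsilon}{1+\varepsilon}}}{1+\sqrt{\frac{1-\varepsilon}{1+\varepsilon}}}.$$ Then $\lim_{\varepsilon\to0^{+}}\delta(\varepsilon)=0$, and whenever $0\le\varepsilon<1$ and $T\in B(H)$ is $\varepsilon$-AOP, there is a linear orthogonality-preserving mapping $S\in B(H)$ such that $$\|T-S\|\le\delta(\varepsilon)\,\min\{\|T\|,\|S\|\}.$$ In particular, if $T\in B(H)$ and $\hat{\varepsilon}(T)<1$, there is a linear orthogonality-preserving mapping $S\in B(H)$ such that $$\|T-S\|\le\delta(\hat{\varepsilon}(T))\,\min\{\|T\|,\|S\|\}=\frac{1-\sqrt{\frac{1-\hat{\varepsilon}(T)}{1+\hat{\varepsilon}(T)}}}{2}\,\|T\|.$$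
   Context: $B(H)$ is the set of bounded linear operators on $H$, with operator norm. A mapping $f:H\to H$ is orthogonality-preserving if $\langle x,y\rangle=0$ implies $\langle f(x),f(y)\rangle=0$ for all $x,y\in H$. For $\varepsilon\in[0,1]$, an operator $T\in B(H)$ is called $\varepsilon$-AOP (approximately orthogonality-preserving) if for all $x,y\in H$ with $\langle x,y\rangle=0$ one has $|\langle Tx,Ty\rangle|\le\varepsilon\|Tx\|\,\|Ty\|$ (so every operator is $1$-AOP). Define $\hat{\varepsilon}(T)=\inf\{\varepsilon\in[0,1]: T\text{ is }\varepsilon\text{-AOP}\}$. *)

(* Defs.v *)
From HB Require Import structures.
From mathcomp Require Import all_boot all_order all_algebra sesquilinear.
From mathcomp Require Import complex.
From mathcomp Require Import all_classical all_reals all_analysis.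

Set Implicit Arguments.
Unset Strict Implicit.
Unset Printing Implicit Defensive.

Import Order.TTheory GRing.Theory Num.Theory.
Import numFieldNormedType.Exports.

Local Open Scope classical_set_scope.
Local Open Scope ring_scope.
Local Open Scope complex_scope.

(* A complex Hilbert space is represented by a complete normed module [H] over
   [R[i]], [R : realType], together with a form [dot : {dot H for Num.conj}]
   (linear in its first argument, conjugate-linear in the second) such that
   [dot x x = `|x| ^+ 2].  Norms on such an [H] take their values in the
   nonnegative reals of [R[i]]. *)

Definition dim_ge2 (R : realType) (H : lmodType R[i]) : Prop :=
  exists u v : H, forall a b : R[i], a *: u + b *: v = 0 -> a = 0 /\ b = 0.

Definition bounded_op (R : realType) (H : normedModType R[i])
    (T : {linear H -> H}) : Prop :=
  exists M : R, forall x : H, `|T x| <= M%:C * `|x|.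

(* [complex.Re] only converts the norm, which is real, from [R[i]] to [R]. *)
Definition opnorm (R : realType) (H : normedModType R[i]) (T : H -> H) : R :=
  sup [set complex.Re `|T x| | x in [set x : H | `|x| <= 1]].

Definition orthogonality_preserving (R : realType) (H : lmodType R[i])
    (dot : {dot H for Num.conj}) (f : H -> H) : Prop :=
  forall x y : H, dot x y = 0 -> dot (f x) (f y) = 0.

Definition AOP (R : realType) (H : normedModType R[i])
    (dot : {dot H for Num.conj}) (eps : R) (T : H -> H) : Prop :=
  forall x y : H, dot x y = 0 ->
    `|dot (T x) (T y)| <= eps%:C * `|T x| * `|T y|.

Definition eps_hat (R : realType) (H : normedModType R[i])
    (dot : {dot H for Num.conj}) (T : H -> H) : R :=
  inf [set eps : R | 0 <= eps <= 1 /\ AOP dot eps T].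

(* The values of [delta] are only meaningful on [0, 1). *)
Definition delta (R : realType) (eps : R) : R :=
  let s := Num.sqrt ((1 - eps) / (1 + eps)) in (1 - s) / (1 + s).

(* Main.v *)
Require Import Defs.
From HB Require Import structures.
From mathcomp Require Import all_boot all_order all_algebra sesquilinear.
From mathcomp Require Import complex.
From mathcomp Require Import ring lra.
From mathcomp Require Import all_classical all_reals all_analysis.

Set Implicit Arguments.
Unset Strict Implicit.
Unset Printing Implicit Defensive.

Import Order.TTheory GRing.Theory Num.Theory.
Import numFieldNormedType.Exports.

Local Open Scope classical_set_scope.
Local Open Scope ring_scope.
Local Open Scope complex_scope.

(* Applying approximate orthogonality to x + y and x - y, for x and y of equal
   norm and real inner product, bounds |T x| / |T y|; hence
   s |T| |x| <= |T x| <= |T| |x| with s^2 = (1 - eps) / (1 + eps).  So in the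
   polar decomposition T = U A the spectrum of A lies in [s |T|, |T|], and
   S := (1 + s) / 2 |T| U, with the midpoint of this interval, satisfies
   |T - S| <= (1 - s) / 2 |T| and |S| = (1 + s) / 2 |T|.  The operator A is
   |T| (1 - Y), where (1 - Y)^2 = T^* T / |T|^2. *)

(** * Geometric sequences *)

Lemma cvg_mul_expr (R : realType) (C r : R) :
  0 <= r < 1 -> C * r ^+ n @[n --> \oo] --> (0 : R).
Proof.
move=> /andP[r0 r1]; rewrite -[X in _ --> X](mulr0 C); apply: cvgMr => //.
by apply: cvg_expr; rewrite ger0_norm.
Qed.

(** Carries identities and inequalities over to a limit: [a] is the defect at the limit, and the
    [n]-th approximation bounds it by a geometric term. *)
Lemma le0_geometric (R : realType) (r C a : R) :
  0 <= r < 1 -> (forall n, a <= C * r ^+ n) -> a <= 0.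
Proof.
move=> r01 h; have c := cvg_mul_expr C r01.
rewrite -(cvg_lim _ c)//; apply: limr_ge; first by apply/cvg_ex; exists 0.
by near=> n; exact: h.
Unshelve. all: by end_near. Qed.

Lemma linear_bundle (K : nzRingType) (U : lmodType K) (f : U -> U) :
  linear f -> exists F : {linear U -> U}, F =1 f.
Proof.
move=> lf.
pose F : {linear U -> U} := HB.pack f (GRing.isLinear.Build _ _ _ _ f lf).
by exists F.
Qed.

(** * The norm as a real number *)

Section RealNorm.
Variables (R : realType) (V : normedModType R[i]).
Implicit Types (x y : V) (t : R).

Definition nrm x : R := complex.Re `|x|.

Lemma nrmE x : `|x| = (nrm x)%:C.
Proof. by rewrite /nrm RRe_real // realE normr_ge0. Qed.

Lemma nrm_ge0 x : 0 <= nrm x.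
Proof. by rewrite -ler0c -nrmE. Qed.

Lemma nrm0 : nrm 0 = 0.
Proof. by rewrite /nrm normr0. Qed.

Lemma nrm0_eq0 x : nrm x <= 0 -> x = 0.
Proof.
move=> h; apply/normr0_eq0; rewrite nrmE.
by rewrite (_ : nrm x = 0) //; apply/eqP; rewrite eq_le h nrm_ge0.
Qed.

Lemma nrmD x y : nrm (x + y) <= nrm x + nrm y.
Proof. by have := ler_normD x y; rewrite !nrmE -rmorphD lecR. Qed.

Lemma nrmN x : nrm (- x) = nrm x.
Proof. by rewrite /nrm normrN. Qed.

Lemma nrmBC x y : nrm (x - y) = nrm (y - x).
Proof. by rewrite -nrmN opprB. Qed.

Lemma nrmB x y : nrm (x - y) <= nrm x + nrm y.
Proof. by rewrite -[nrm y]nrmN; exact: nrmD. Qed.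

Lemma nrmZ (a : R[i]) x : nrm (a *: x) = complex.Re `|a| * nrm x.
Proof.
rewrite /nrm normrZ [`|x|]nrmE [in LHS](_ : `|a| = (complex.Re `|a|)%:C).
  by rewrite -rmorphM.
by rewrite RRe_real // realE normr_ge0.
Qed.

Lemma nrmZr t x : nrm (t%:C *: x) = `|t| * nrm x.
Proof. by rewrite nrmZ normc_def /= expr0n /= addr0 sqrtr_sqr. Qed.

End RealNorm.

(** The tail of a geometric series gives both the Cauchy property and the rate; the explicit rate is
    what feeds [le0_geometric] later. *)
Lemma nrm_cauchy_limit (R : realType) (V : completeNormedModType R[i])
    (u : nat -> V) (K r : R) :
  0 <= r < 1 -> (forall n, nrm (u n.+1 - u n) <= K * r ^+ n) ->
  exists l, forall n, nrm (u n - l) <= K / (1 - r) * r ^+ n.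
Proof.
move=> /[dup] r01 /andP[r0 r1] h.
have s0 : 0 < 1 - r by lra.
have K0 : 0 <= K.
  by have := h 0%N; rewrite expr0 mulr1; apply: le_trans; exact: nrm_ge0.
have far k n : nrm (u (n + k)%N - u n) <= K / (1 - r) * r ^+ n.
  elim: k n => [|k IH] n.
    rewrite addn0 subrr nrm0 mulr_ge0 ?exprn_ge0 ?divr_ge0 //; exact: ltW.
  rewrite addnS -addSn -(subrKA (u n.+1)).
  apply: le_trans (nrmD _ _) _; apply: le_trans (lerD (IH n.+1) (h n)) _.
  (* The two bounds add up exactly: r^(n+1) / (1 - r) + r^n = r^n / (1 - r). *)
  rewrite exprS le_eqVlt; apply/orP; left; apply/eqP; field.
  by rewrite gt_eqF.
have small (e : R) : 0 < e -> \forall n \near \oo, K / (1 - r) * r ^+ n < e.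
  by move=> e0; exact: (cvgr_lt 0 (cvg_mul_expr (K / (1 - r)) r01) e e0).
have cu : cvg (u @ \oo).
  apply: cauchy_cvg; apply: cauchy_exP => e e0.
  have [d e_d] : exists d : R, e = d%:C.
    by exists (complex.Re e); rewrite RRe_real // gtr0_real.
  have d0 : 0 < d by rewrite -ltcR -e_d.
  have [N _ hN] := small d d0.
  exists (u N); exists N => // n /= Nn.
  rewrite -ball_normE /= e_d nrmE ltcR nrmBC.
  by rewrite -(subnKC Nn); apply: le_lt_trans (far _ _) (hN N (leqnn N)).
exists (lim (u @ \oo)) => n; apply/ler_addgt0Pr => e e0.
have eC : 0 < e%:C by rewrite ltcR.
have [N _ hN] := (cvgrPdist_lt _ _).1 cu _ eC.
have := hN (n + N)%N (leq_addl _ _) => /=.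
rewrite nrmE ltcR => lt1.
rewrite -(subrKA (u (n + N)%N)); apply: le_trans (nrmD _ _) _.
by rewrite nrmBC; apply: lerD; [exact: far | rewrite nrmBC; exact: ltW].
Qed.

(** * The underlying real inner product *)

Section RealPart.
Variables (R : realType) (H : normedModType R[i]) (dot : {dot H for Num.conj}).
Hypothesis dot_norm : forall x : H, dot x x = `|x| ^+ 2.
Implicit Types (x y z : H) (t r : R).

Definition rdot x y : R := complex.Re (dot x y).

Lemma conj_conjc (a : R[i]) : Num.conj a = (a^*)%C.
Proof. by []. Qed.

Lemma dotC x y : dot x y = (dot y x)^*.
Proof. by rewrite hermC mul1r. Qed.

Lemma rdotC x y : rdot x y = rdot y x.
Proof. by rewrite /rdot dotC; case: (dot y x). Qed.

Lemma rdotDl x y z : rdot (x + y) z = rdot x z + rdot y z.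
Proof. by rewrite /rdot linearDl raddfD. Qed.

Lemma rdotDr x y z : rdot x (y + z) = rdot x y + rdot x z.
Proof. by rewrite rdotC rdotDl !(rdotC x). Qed.

Lemma rdotZl t x y : rdot (t%:C *: x) y = t * rdot x y.
Proof.
rewrite /rdot linearZl_LR /=; case: (dot x y) => a b /=.
by rewrite mul0r subr0.
Qed.

Lemma rdotZr t x y : rdot x (t%:C *: y) = t * rdot x y.
Proof. by rewrite rdotC rdotZl rdotC. Qed.

Lemma rdotZJ (a : R[i]) x y : rdot (a *: x) y = rdot x (a^*%C *: y).
Proof. by rewrite /rdot linearZl_LR linearZr_LR /= conj_conjc conjcK. Qed.

Lemma rdotNl x y : rdot (- x) y = - rdot x y.
Proof. by rewrite /rdot linearNl raddfN. Qed.

Lemma rdotNr x y : rdot x (- y) = - rdot x y.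
Proof. by rewrite rdotC rdotNl rdotC. Qed.

Lemma rdot0l x : rdot 0 x = 0.
Proof. by rewrite -(scale0r x) -[0]/(0%:C) rdotZl mul0r. Qed.

Definition rdotE := (rdotDl, rdotDr, rdotNl, rdotNr, rdotZl, rdotZr).

Lemma rdotxx x : rdot x x = nrm x ^+ 2.
Proof. by rewrite /rdot dot_norm nrmE -rmorphXn. Qed.

(** Expands the square of the norm of |y| x - |x| y, which equals 2 |x| |y| (|x| |y| -
    [rdot x y]). *)
Lemma rdot_le x y : rdot x y <= nrm x * nrm y.
Proof.
have [->|x0] := eqVneq x 0; first by rewrite rdot0l nrm0 mul0r.
have [->|y0] := eqVneq y 0; first by rewrite rdotC rdot0l nrm0 mulr0.
have p (v : H) : v != 0 -> 0 < nrm v.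
  by rewrite lt_def nrm_ge0 andbT; apply: contraNneq => e; apply/eqP/nrm0_eq0; rewrite e.
move: (p _ x0) (p _ y0) => {p x0 y0} px py.
have : 0 <= rdot ((nrm y)%:C *: x - (nrm x)%:C *: y) ((nrm y)%:C *: x - (nrm x)%:C *: y).
  by rewrite rdotxx exprn_ge0 ?nrm_ge0.
rewrite !rdotE !rdotxx (rdotC y x) => h.
have : 0 <= (nrm x * nrm y) * (nrm x * nrm y - rdot x y) by nra.
by rewrite pmulr_rge0 ?mulr_gt0 // subr_ge0.
Qed.

Lemma rdot_inj x y : (forall z, rdot x z = rdot y z) -> x = y.
Proof.
move=> h; apply/eqP; rewrite -subr_eq0; apply/eqP/nrm0_eq0.
have : nrm (x - y) ^+ 2 = 0 by rewrite -rdotxx rdotDl rdotNl h subrr.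
by move/eqP; rewrite sqrf_eq0 => /eqP ->.
Qed.

(** Transfers to [dot] what a complex linear operator does to [rdot]. *)
Lemma dot_rdot x y : dot x y = rdot x y +i* rdot x ('i%C *: y).
Proof.
rewrite /rdot linearZr_LR /=; case: (dot x y) => a b /=.
by congr (_ +i* _); ring.
Qed.

Lemma nrm_sqrD x y : nrm (x + y) ^+ 2 = nrm x ^+ 2 + nrm y ^+ 2 + 2 * rdot x y.
Proof. by rewrite -!rdotxx !rdotE (rdotC y x); ring. Qed.

Lemma parallelogram x y :
  nrm (x + y) ^+ 2 + nrm (x - y) ^+ 2 = 2 * (nrm x ^+ 2 + nrm y ^+ 2).
Proof. by rewrite !nrm_sqrD nrmN rdotNr; ring. Qed.

(** Polarization: by symmetry, 4 [rdot (A x) y] is the difference of the quadratic form at x + y and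
    x - y, hence at most 2 r (|x|^2 + |y|^2). Take [y] along [A x] with |y| = |x|. *)
Lemma selfadjoint_bound (A : {linear H -> H}) r :
  (forall x y, rdot (A x) y = rdot x (A y)) ->
  (forall x, `|rdot (A x) x| <= r * nrm x ^+ 2) ->
  forall x, nrm (A x) <= r * nrm x.
Proof.
move=> sA hA x.
have [x0|x0] := leP (nrm x) 0.
  by rewrite (nrm0_eq0 x0) linear0 nrm0 mulr0.
(* When [A x = 0], the sign of [r] is read off from the hypothesis at [x]. *)
have [a0|a0] := leP (nrm (A x)) 0.
  have := hA x; rewrite (nrm0_eq0 a0) rdot0l normr0 nrm0 => h.
  have : 0 <= (r * nrm x) * nrm x by rewrite -mulrA -expr2.
  by rewrite pmulr_lge0.
pose y := (nrm x / nrm (A x))%:C *: A x.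
have ny : nrm y = nrm x.
  rewrite nrmZr ger0_norm ?divr_ge0 ?nrm_ge0 // divfK //.
  by rewrite gt_eqF.
have dy : rdot (A x) y = nrm (A x) * nrm x.
  by rewrite rdotZr rdotxx; field; rewrite gt_eqF.
move: y ny dy => y ny dy.
have := hA (x + y); have := hA (x - y); rewrite !ler_norml.
move=> /andP[h1 _] /andP[_ h2]; move: h1 h2.
have := congr1 ( *%R r) (parallelogram x y).
rewrite ny !linearD !linearN !rdotE (sA y x) (rdotC y (A x)) dy => pl h1 h2.
have : 0 <= (r * nrm x - nrm (A x)) * nrm x by nra.
by rewrite pmulr_lge0 // subr_ge0.
Qed.

(* As [|x| = |y|], [x + y] and [x - y] become orthogonal once the phase of [y]
   is rotated so that [dot x y] is real. *)
Lemma AOP_nrm_le (eps : R) (T : {linear H -> H}) : 0 <= eps -> AOP dot eps T ->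
  forall x y, nrm x = nrm y ->
  (1 - eps) * nrm (T x) ^+ 2 <= (1 + eps) * nrm (T y) ^+ 2.
Proof.
move=> e0 hT x y nxy.
wlog im0 : y nxy / complex.Im (dot x y) = 0.
  move=> W; have [d0|d0] := eqVneq (dot x y) 0; first by apply: W; rewrite ?d0.
  pose n := complex.Re `|dot x y|.
  have nE : `|dot x y| = n%:C by rewrite RRe_real // realE normr_ge0.
  have n0 : n != 0 by rewrite -(inj_eq (@complexI R)) -nE normr_eq0.
  pose c := dot x y * (n^-1)%:C.
  have n1 (v : H) : nrm (c *: v) = nrm v.
    have nV : (n^-1)%:C = (n%:C)^-1 by exact: fmorphV.
    by rewrite nrmZ normrM nV normfV -nE normr_id divff ?mul1r ?normr_eq0.
  have := W (c *: y); rewrite (linearZ_LR T) /= !n1; apply => //.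
  have -> : dot x (c *: y) = n%:C; last by [].
  have cJ : (c^*)%C = (dot x y)^*%C * (n^-1)%:C.
    by rewrite /c rmorphM; congr (_ * _); exact: conjc_real.
  rewrite linearZr_LR /= conj_conjc cJ mulrAC [_^*%C * _]mulrC -sqr_normc nE.
  by rewrite -rmorphXn -rmorphM expr2 mulfK.
have orth : dot (x + y) (x - y) = 0.
  rewrite linearDl !linearBr /= !dot_norm !nrmE nxy (dotC y x).
  by move: im0; case: (dot x y) => a b /= ->; rewrite oppr0; ring.
have := hT _ _ orth; rewrite !(linearD T) (linearN T) => h.
have {h} := le_trans (normc_ge_Re _) h.
rewrite !nrmE -!rmorphM lecR -[complex.Re _]/(rdot (T x + T y) (T x - T y))
  !rdotE !rdotxx (rdotC (T y)) ler_norml.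
move=> /andP[_].
have := parallelogram (T x) (T y).
set u := nrm (T x + T y); set v := nrm (T x - T y) => pl h.
(* |T x|^2 - |T y|^2 <= eps u v <= eps (u^2 + v^2) / 2, and the last term is eps (|T x|^2 + |T y|^2)
   by the parallelogram law. *)
have : 0 <= eps * (u - v) ^+ 2 by rewrite mulr_ge0 ?sqr_ge0.
nra.
Qed.

End RealPart.

(** * Limits of operators and the Neumann series *)

(** The limit is taken pointwise. Since each [u n] is linear, the linearity defect of the limit is
    at most the sum of the errors at the three vectors involved, which decays geometrically. *)
Lemma linear_limit (R : realType) (V : completeNormedModType R[i]) (r : R)
    (u : nat -> {linear V -> V}) :
  0 <= r < 1 -> (forall n x, nrm (u n.+1 x - u n x) <= r ^+ n * nrm x) ->
  exists L : {linear V -> V},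
    forall n x, nrm (u n x - L x) <= nrm x / (1 - r) * r ^+ n.
Proof.
move=> r01 h.
have /choice[L hL] : forall x, exists l,
    forall n, nrm (u n x - l) <= nrm x / (1 - r) * r ^+ n.
  by move=> x; apply: nrm_cauchy_limit => // n; rewrite mulrC; exact: h.
suff linL : linear L.
  by have [L' L'E] := linear_bundle linL; exists L' => n x; rewrite L'E.
move=> a x y; apply/eqP; rewrite -subr_eq0; apply/eqP/nrm0_eq0.
apply: (@le0_geometric _ r (nrm (a *: x + y) / (1 - r) +
  (complex.Re `|a| * (nrm x / (1 - r)) + nrm y / (1 - r)))) => // n.
have E : u n (a *: x + y) - (a *: L x + L y) = a *: (u n x - L x) + (u n y - L y).
  by rewrite linearP opprD addrACA scalerBr.
rewrite -(subrKA (u n (a *: x + y))) E.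
rewrite mulrDl; apply: le_trans (nrmD _ _) _; apply: lerD.
  by rewrite nrmBC.
rewrite mulrDl; apply: le_trans (nrmD _ _) _; apply: lerD => //.
by rewrite nrmZ -mulrA; apply: ler_wpM2l => //; rewrite -ler0c RRe_real ?realE normr_ge0.
Qed.

(* Neumann series, as the fixed point of [Z = 1 + Y Z]. *)
Lemma neumann (R : realType) (V : completeNormedModType R[i]) (r : R)
    (Y : {linear V -> V}) :
  0 <= r < 1 -> (forall x, nrm (Y x) <= r * nrm x) ->
  exists Z : {linear V -> V}, forall x, Z x - Y (Z x) = x.
Proof.
move=> /[dup] r01 /andP[r0 r1] hY.
pose u := nat_rect (fun=> {linear V -> V}) (\0 : {linear V -> V})
  (fun _ Z => (idfun \+ (Y \o Z) : {linear V -> V})).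
have uS n x : u n.+1 x = x + Y (u n x) by [].
have [n x|Z hZ] := @linear_limit R V r u r01.
  elim: n => [|n IH]; first by rewrite uS linear0 subr0 addr0 expr0 mul1r.
  rewrite !(uS _.+1) (uS n) opprD addrACA subrr add0r -linearB exprS -mulrA.
  by apply: le_trans (hY _) _; rewrite ler_wpM2l // -uS.
exists Z => x; apply/eqP; rewrite -subr_eq0; apply/eqP/nrm0_eq0.
pose k := nrm x / (1 - r).
apply: (@le0_geometric _ r (k * r + r * k)) => // n.
have -> : Z x - Y (Z x) - x = (Z x - u n.+1 x) + Y (u n x - Z x).
  by rewrite uS linearB opprD !addrA subrK addrAC.
apply: le_trans (nrmD _ _) _; rewrite mulrDl; apply: lerD.
  by rewrite nrmBC; apply: le_trans (hZ _ _) _; rewrite exprS mulrA.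
by apply: le_trans (hY _) _; rewrite -mulrA ler_wpM2l.
Qed.

(** * Riesz representation and the operator T^* T *)

Section Hilbert.
Variables (R : realType) (H : completeNormedModType R[i]).
Variable dot : {dot H for Num.conj}.
Hypothesis dot_norm : forall x : H, dot x x = `|x| ^+ 2.
Implicit Types (x y z : H) (t r s : R).
Local Notation rdot := (rdot dot).

(* Minimizes [|z|^2 - 2 g z]. *)
Lemma riesz (g : H -> R) (K : R) :
  (forall x y, g (x + y) = g x + g y) -> (forall t x, g (t%:C *: x) = t * g x) ->
  (forall x, g x <= K * nrm x) -> exists z, forall y, g y = rdot z y.
Proof.
move=> gD gZ gK.
pose J z := nrm z ^+ 2 - 2 * g z.
have JK z : - K ^+ 2 <= J z.
  by rewrite /J; have := gK z; have := sqr_ge0 (nrm z - K); nra.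
pose E := [set J z | z in [set: H]].
have hE : has_inf E.
  by split; [exists (J 0); exists 0 | exists (- K ^+ 2) => _ [z _ <-]].
pose m := inf E.
have mJ z : m <= J z by apply: ge_inf; [exact: hE.2 | exists z].
pose e n : R := 2^-1 ^+ n.
have e0 n : 0 < e n by rewrite exprn_gt0 // invr_gt0.
(* With this tolerance [Jmid] gives |z (n+1) - z n|^2 <= 5/8 (e n)^2, so consecutive distances are
   at most 2^-n. *)
have /choice[z hz] : forall n, exists z, J z <= m + e n ^+ 2 / 4.
  move=> n; have : 0 < e n ^+ 2 / 4 by rewrite divr_gt0 // exprn_gt0.
  by move=> /inf_adherent/(_ hE)[_ [z _ <-] lt]; exists z; exact: ltW.
have eS n : e n.+1 = e n / 2 by rewrite /e exprS mulrC.
(* The midpoint of [x] and [y] also has value at least [m]; the parallelogram law turns this into a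
   bound on their distance. *)
have Jmid x y : nrm (x - y) ^+ 2 <= 2 * J x + 2 * J y - 4 * m.
  have := mJ ((2^-1)%:C *: (x + y)); have := parallelogram dot_norm x y.
  by rewrite /J nrmZr gZ gD ger0_norm ?invr_ge0 // exprMn; lra.
have [|n|l hl] := @nrm_cauchy_limit R H z 1 2^-1; first by lra.
  rewrite mul1r -/(e n) -(@ler_pXn2r _ 2) ?nnegrE ?nrm_ge0 //; last exact: ltW.
  apply: le_trans (Jmid _ _) _; have := hz n; have := hz n.+1; rewrite eS.
  by have := sqr_ge0 (e n); nra.
have key y : rdot l y <= g y.
  rewrite -subr_le0.
  apply: (@le0_geometric _ 2^-1 (nrm y ^+ 2 / 2 + 8^-1 + 2 * nrm y)); first by lra.
  move=> n; rewrite -/(e n).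
  have h1 : rdot (l - z n) y <= 2 * e n * nrm y.
    apply: le_trans (rdot_le dot_norm _ _) _; apply: ler_wpM2r; first exact: nrm_ge0.
    rewrite nrmBC; apply: le_trans (hl n) _.
    by rewrite -/(e n) le_eqVlt; apply/orP; left; apply/eqP; field.
  (* First variation along [y]: with a step of size [e n], the excess (e n)^2 / 4 of [z n] over the
     infimum is still of order [e n] after division by the step. *)
  have h2 := mJ (z n + (- e n)%:C *: y); have h3 := hz n.
  move: h2 h3 h1; rewrite /J (nrm_sqrD dot_norm) nrmZr gD gZ exprMn real_normK ?num_real // !rdotE.
  move=> h2 h3 h1.
  have h4 : 0 <= e n * (e n / 8 - (rdot (z n) y - g y) + e n * nrm y ^+ 2 / 2) by nra.
  rewrite pmulr_rge0 // in h4; lra.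
exists l => y; apply/eqP; rewrite eq_le key andbT.
have := key (- y).
by rewrite rdotNr -[- y]scaleN1r -(rmorphN1 (real_complex R)) gZ mulN1r lerN2.
Qed.

(** Riesz applied to the real functionals y |-> [rdot (T x) (T y)]. Complex linearity is recovered
    by moving a scalar, conjugated, to the second argument, where the linearity of [T] absorbs
    it. *)
Lemma gram_operator (T : {linear H -> H}) (b : R) :
  0 <= b -> (forall x, nrm (T x) <= b * nrm x) ->
  exists P : {linear H -> H}, forall x y, rdot (P x) y = rdot (T x) (T y).
Proof.
move=> b0 hT.
have /choice[P hP] : forall x, exists z, forall y, rdot (T x) (T y) = rdot z y.
  move=> x; apply: (@riesz _ (nrm (T x) * b)) => [y z|t y|y].
  - by rewrite linearD rdotDr.
  - by rewrite (linearZ_LR T) /= rdotZr.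
  - apply: le_trans (rdot_le dot_norm _ _) _.
    by rewrite -mulrA; apply: ler_wpM2l; rewrite ?nrm_ge0.
suff linP : linear P.
  by have [L LE] := linear_bundle linP; exists L => x y; rewrite LE hP.
move=> a x y; apply: (rdot_inj dot_norm) => z.
by rewrite -hP linearP !rdotDl !rdotZJ -!hP (linearZ_LR T).
Qed.

End Hilbert.

(** * Operator square root and the conformal part of T *)

Section Polar.
Variables (R : realType) (H : completeNormedModType R[i]).
Variable dot : {dot H for Num.conj}.
Hypothesis dot_norm : forall x : H, dot x x = `|x| ^+ 2.
Implicit Types (x y z : H) (s : R).
Local Notation rdot := (rdot dot).

(* [1 - Y] is the square root of [1 - Q]; [Y] is the limit of the iteration
   [Y := (Q + Y^2) / 2] started at [0], which contracts with ratio [1 - s]. *)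
Lemma sqrt_operator (Q : {linear H -> H}) s :
  0 < s <= 1 -> (forall x y, rdot (Q x) y = rdot x (Q y)) ->
  (forall x, nrm (Q x) <= (1 - s ^+ 2) * nrm x) ->
  exists Y : {linear H -> H},
    [/\ forall x y, rdot (Y x) y = rdot x (Y y),
        forall x, nrm (Y x) <= (1 - s) * nrm x &
        forall x, Y x = (2^-1)%:C *: (Q x + Y (Y x))].
Proof.
move=> /andP[s0 s1] sQ hQ.
pose r := 1 - s.
have r01 : 0 <= r < 1 by rewrite /r; lra.
have r0 : 0 <= r by case/andP: r01.
have half2 : `|2^-1 : R| = 2^-1 by rewrite ger0_norm // invr_ge0.
pose u := nat_rect (fun=> {linear H -> H}) (\0 : {linear H -> H})
  (fun _ Z => ((2^-1)%:C \*: (Q \+ (Z \o Z)) : {linear H -> H})).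
have uS n x : u n.+1 x = (2^-1)%:C *: (Q x + u n (u n x)) by [].
have su n x y : rdot (u n x) y = rdot x (u n y).
  elim: n x y => [|n IH] x y; first by rewrite rdot0l rdotC rdot0l.
  by rewrite !uS !rdotE sQ !IH.
(* The bound reproduces itself: ((1 - s^2) + (1 - s)^2) / 2 = 1 - s. *)
have nu n x : nrm (u n x) <= r * nrm x.
  elim: n x => [|n IH] x; first by rewrite nrm0 mulr_ge0 ?nrm_ge0.
  rewrite uS nrmZr half2.
  have h1 := nrmD (Q x) (u n (u n x)); have h2 := hQ x.
  have h3 : nrm (u n (u n x)) <= r * (r * nrm x).
    by apply: le_trans (IH _) _; rewrite ler_wpM2l.
  by move: h1 h2 h3; rewrite /r; lra.
(* A^2 - B^2 = A (A - B) + (A - B) B holds without commutation. For two iterates each summand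
   contributes a factor [r], and the half in the iteration absorbs their number. *)
have split2 (A B : {linear H -> H}) x :
    A (A x) - B (B x) = A (A x - B x) + (A (B x) - B (B x)).
  by rewrite linearB subrKA.
have [n x|Y hY] := @linear_limit R H r u r01.
  elim: n x => [|n IH] x.
    rewrite uS addr0 subr0 nrmZr half2 expr0 mul1r.
    by have := hQ x; have := nrm_ge0 x; have := nrm_ge0 (Q x); nra.
  rewrite (uS n.+1) (uS n) -scalerBr opprD addrACA subrr add0r nrmZr half2.
  rewrite (split2 (u n.+1) (u n)).
  have h1 := nu n.+1 (u n.+1 x - u n x).
  have h2 := ler_wpM2l r0 (IH x).
  have h3 := IH (u n x).
  have h4 := ler_wpM2l (exprn_ge0 n r0) (nu n x).
  rewrite exprS.
  apply: le_trans (ler_wpM2l _ (nrmD _ _)) _; first by rewrite invr_ge0.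
  lra.
pose k (x : H) : R := nrm x / (1 - r).
have sY x y : rdot (Y x) y - rdot x (Y y) <= 0.
  apply: (@le0_geometric _ r (k x * nrm y + nrm x * k y)) => // n.
  have -> : rdot (Y x) y - rdot x (Y y) =
      rdot (- (u n x - Y x)) y + rdot x (u n y - Y y).
    by rewrite !rdotE su; ring.
  have h1 := rdot_le dot_norm (- (u n x - Y x)) y.
  have h2 := rdot_le dot_norm x (u n y - Y y).
  rewrite nrmN in h1.
  have h3 := ler_wpM2r (nrm_ge0 y) (hY n x).
  have h4 := ler_wpM2l (nrm_ge0 x) (hY n y).
  rewrite -/(k _) in h3; rewrite -/(k _) in h4; lra.
have nY x : nrm (Y x) <= r * nrm x.
  rewrite -subr_le0; apply: (@le0_geometric _ r (k x)) => // n.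
  have h1 := nrmB (u n x) (u n x - Y x); rewrite subKr in h1.
  have h2 := nu n x; have h3 := hY n x; rewrite -/(k x) in h3; lra.
exists Y; split => //.
  move=> x y; apply/eqP; rewrite eq_le -subr_le0 sY /= -subr_le0.
  by rewrite rdotC [X in _ - X]rdotC sY.
move=> x; apply/eqP; rewrite eq_sym -subr_eq0; apply/eqP/nrm0_eq0.
apply: (@le0_geometric _ r (2 * (r * k x))) => // n.
have -> : (2^-1)%:C *: (Q x + Y (Y x)) - Y x =
    (2^-1)%:C *: (Y (Y x) - u n (u n x)) + (u n.+1 x - Y x).
  rewrite uS [RHS]addrA -scalerDr; congr (_ *: _ - _).
  by rewrite [Q x + u _ _]addrC subrKA addrC.
have h1 := nrmD ((2^-1)%:C *: (Y (Y x) - u n (u n x))) (u n.+1 x - Y x).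
rewrite nrmZr half2 in h1.
have h2 := nrmD (Y (Y x - u n x)) (Y (u n x) - u n (u n x)).
rewrite -(split2 Y (u n)) in h2.
have h3 : nrm (Y (Y x - u n x)) <= r * (k x * r ^+ n).
  by apply: le_trans (nY _) _; rewrite ler_wpM2l // nrmBC.
have h4 : nrm (Y (u n x) - u n (u n x)) <= r * k x * r ^+ n.
  rewrite nrmBC; apply: le_trans (hY _ _) _; rewrite ler_wpM2r ?exprn_ge0 //.
  by rewrite /k mulrA ler_wpM2r ?nu // invr_ge0 /r; lra.
have h5 := hY n.+1 x; rewrite exprS in h5; rewrite -/(k x) in h5.
lra.
Qed.

(** With B = 1 - Y one has T^* T = b^2 B^2, so for a right inverse Z of B the operator b^-1 T Z is
    isometric. It serves as the factor U, and S = c T Z with c = (1 + s) / 2. *)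
Lemma nearest_conformal (T : {linear H -> H}) (b s : R) :
  0 < b -> 0 < s <= 1 -> (forall x, nrm (T x) <= b * nrm x) ->
  (forall x, s * b * nrm x <= nrm (T x)) ->
  exists S : {linear H -> H},
    (forall x y, rdot (S x) (S y) = ((1 + s) / 2 * b) ^+ 2 * rdot x y) /\
    (forall x, nrm (T x - S x) <= (1 - s) / 2 * b * nrm x).
Proof.
move=> b0 s01 hT Th.
have bN0 : b != 0 by rewrite gt_eqF.
have [P hP] := gram_operator dot_norm (ltW b0) hT.
have [Q QE] : exists Q : {linear H -> H}, forall x y,
    rdot (Q x) y = rdot x y - b ^- 2 * rdot (T x) (T y).
  by exists (idfun \- ((b ^- 2)%:C \*: P)) => x y; rewrite /= !rdotE hP.
have sQ x y : rdot (Q x) y = rdot x (Q y) by rewrite (rdotC _ x) !QE rdotC (rdotC _ (T x)).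
(* Q = 1 - b^-2 T^* T, and the two bounds on |T x| place its quadratic form between 0 and (1 - s^2)
   |x|^2. *)
have hQ x : nrm (Q x) <= (1 - s ^+ 2) * nrm x.
  apply: (selfadjoint_bound dot_norm sQ) => {}x.
  rewrite QE !rdotxx //.
  have -> : nrm x ^+ 2 - b ^- 2 * nrm (T x) ^+ 2 =
      nrm x ^+ 2 - (nrm (T x) / b) ^+ 2 by field.
  have h1 : nrm (T x) / b <= nrm x by rewrite ler_pdivrMr // mulrC.
  have h2 : s * nrm x <= nrm (T x) / b.
    by rewrite ler_pdivlMr // mulrAC.
  have h0 := nrm_ge0 x; case/andP: s01 => s0 s1.
  have h3 : (nrm (T x) / b) ^+ 2 <= nrm x ^+ 2.
    by rewrite ler_pXn2r // nnegrE ?divr_ge0 ?nrm_ge0 // ltW.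
  have h4 : (s * nrm x) ^+ 2 <= (nrm (T x) / b) ^+ 2.
    by rewrite ler_pXn2r // nnegrE ?divr_ge0 ?mulr_ge0 ?nrm_ge0 // ltW.
  by rewrite ger0_norm ?subr_ge0 //; lra.
have [Y [sY nY YE]] := sqrt_operator s01 sQ hQ.
have [B BE] : exists B : {linear H -> H}, forall x, B x = x - Y x.
  by exists (idfun \- Y).
(* B^2 = 1 - 2 Y + Y^2 = 1 - Q, because 2 Y = Q + Y^2. *)
have BB x y : b ^+ 2 * rdot (B x) (B y) = rdot (T x) (T y).
  have e2 : 2 * rdot x (Y y) = rdot x (Q y) + rdot x (Y (Y y)).
    by rewrite [in LHS]YE !rdotE; field.
  have e1 : rdot x (Q y) = rdot x y - b ^- 2 * rdot (T x) (T y) by rewrite -sQ QE.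
  rewrite !BE !rdotE !sY.
  have -> : rdot (T x) (T y) = b ^+ 2 * (rdot x y - rdot x (Q y)).
    by rewrite e1; field.
  by congr (_ * _); lra.
have TB x : nrm (T x) = b * nrm (B x).
  apply/eqP; rewrite -(@eqrXn2 _ 2) ?mulr_ge0 ?nrm_ge0 // ?ltW //.
  by rewrite exprMn -!(rdotxx dot_norm) BB.
have [|Z hZ] := neumann _ nY; first lra.
have BZ x : B (Z x) = x by rewrite BE.
pose c := (1 + s) / 2.
pose S : {linear H -> H} := c%:C \*: (T \o Z).
exists S; split=> [x y|x].
  by rewrite /S /= !rdotE -BB !BZ /c; ring.
pose W : {linear H -> H} := ((1 - c)%:C \*: idfun) \- Y.
(* Writing x = B (Z x) puts [T] in front; |T w| = b |B w| then reduces the estimate to the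
   self-adjoint operator B - c. *)
have -> : T x - S x = T (B (Z x) - c%:C *: Z x).
  by rewrite linearB (linearZ_LR T) BZ.
rewrite TB linearB (linearZ_LR B) /= !BZ.
have -> : B x - c%:C *: x = W x.
  by rewrite BE /W /= rmorphB scalerBl scale1r addrAC.
rewrite mulrAC mulrC ler_wpM2r ?(ltW b0) //.
apply: (selfadjoint_bound dot_norm) => {}x.
  by move=> y; rewrite /W /= !rdotE sY.
(* As 1 - c = (1 - s) / 2, it remains to see 0 <= [rdot (Y x) x] <= (1 - s) |x|^2. The upper bound
   comes from [nY], the lower one from |B x| <= |x|. *)
have Yx1 := rdot_le dot_norm (Y x) x.
have Yx2 := rdot_le dot_norm (B x) x.
have n1 := nY x; have n0 := nrm_ge0 x.
have n2 : nrm (B x) <= nrm x by rewrite -(ler_pM2l b0) -TB.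
rewrite BE !rdotE (rdotxx dot_norm) -BE in Yx2.
rewrite /W /= !rdotE (rdotxx dot_norm) /c ler_norml.
apply/andP; split; nra.
Qed.

End Polar.

(** * The operator norm *)

Section OperatorNorm.
Variables (R : realType) (H : normedModType R[i]).
Implicit Types (f : H -> H) (x : H) (K : R).

Lemma bounded_opP (T : {linear H -> H}) :
  bounded_op T <-> exists2 M : R, 0 <= M & forall x, nrm (T x) <= M * nrm x.
Proof.
split=> [[M hM]|[M M0 hM]]; last first.
  by exists M => x; rewrite !nrmE -rmorphM lecR.
exists `|M| => // x; apply: (@le_trans _ _ (M * nrm x)).
  by have := hM x; rewrite !nrmE -rmorphM lecR.
by rewrite ler_wpM2r ?nrm_ge0 // ler_norm.
Qed.

Lemma opnorm_le f K : 0 <= K -> (forall x, nrm (f x) <= K * nrm x) ->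
  opnorm f <= K.
Proof.
move=> K0 hK; apply: ge_sup; first by exists (nrm (f 0)); exists 0 => //=; rewrite normr0.
move=> _ [x /= x1 <-]; apply: le_trans (hK x) _.
by rewrite -[leRHS]mulr1 ler_wpM2l // -lecR -nrmE.
Qed.

Lemma nrm_le_opnorm (T : {linear H -> H}) x :
  bounded_op T -> nrm (T x) <= opnorm T * nrm x.
Proof.
move=> /bounded_opP[M M0 hM].
have [x0|x0] := leP (nrm x) 0; first by rewrite (nrm0_eq0 x0) linear0 !nrm0 mulr0.
rewrite -ler_pdivrMr // mulrC.
have -> : (nrm x)^-1 * nrm (T x) = nrm (T ((nrm x)^-1%:C *: x)).
  by rewrite (linearZ_LR T) nrmZr ger0_norm // invr_ge0 ltW.
apply: ub_le_sup; last first.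
  exists ((nrm x)^-1%:C *: x) => //=.
  by rewrite nrmE nrmZr ger0_norm ?invr_ge0 ?(ltW x0) // mulVf ?gt_eqF.
exists M => _ [y /= y1 <-]; apply: le_trans (hM y) _.
by rewrite -[leRHS]mulr1 ler_wpM2l // -lecR -nrmE.
Qed.

Lemma opnorm_ge0 (T : {linear H -> H}) : bounded_op T -> 0 <= opnorm T.
Proof.
move=> /bounded_opP[M M0 hM]; apply: ub_le_sup.
  exists M => _ [y /= y1 <-]; apply: le_trans (hM y) _.
  by rewrite -[leRHS]mulr1 ler_wpM2l // -lecR -nrmE.
by exists 0; rewrite /= ?linear0 normr0.
Qed.

Lemma opnorm_conformal (T : {linear H -> H}) K : (exists x : H, x != 0) ->
  0 <= K -> (forall x, nrm (T x) = K * nrm x) -> opnorm T = K.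
Proof.
move=> [x x0] K0 hK; apply/eqP; rewrite eq_le opnorm_le //=; last first.
  by move=> y; rewrite hK.
have px : 0 < nrm x by rewrite -ltcR -nrmE normr_gt0.
have : nrm (T x) <= opnorm T * nrm x.
  by apply: nrm_le_opnorm; apply/bounded_opP; exists K => // y; rewrite hK.
by rewrite hK ler_pM2r.
Qed.

End OperatorNorm.

(** * The function [delta] *)

Section Delta.
Variable R : realType.
Implicit Types eps : R.

Lemma ratio_sqrt_gt0_le1 eps : 0 <= eps < 1 ->
  0 < Num.sqrt ((1 - eps) / (1 + eps)) <= 1.
Proof.
move=> e01; rewrite sqrtr_gt0 divr_gt0 ?subr_gt0 /=; try lra.
rewrite -[leRHS]sqrtr1 ler_wsqrtr // ler_pdivrMr; lra.
Qed.

(** Since eps = (1 - s^2) / (1 + s^2), the upper bound amounts to 1 + s^2 <= (1 + s)^2. It yields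
    the limit at 0 by squeezing. *)
Lemma delta_bounds eps : 0 <= eps < 1 -> 0 <= delta eps <= eps.
Proof.
move=> e01; rewrite /delta /=.
have := ratio_sqrt_gt0_le1 e01.
have : Num.sqrt ((1 - eps) / (1 + eps)) ^+ 2 = (1 - eps) / (1 + eps).
  by rewrite sqr_sqrtr // divr_ge0; lra.
set s := Num.sqrt _ => s2 /andP[s0 s1].
have {}s2 : s ^+ 2 * (1 + eps) = 1 - eps by rewrite s2 divfK // gt_eqF; lra.
rewrite divr_ge0 ?subr_ge0 ?addr_ge0 ?(ltW s0) //= ler_pdivrMr; last by lra.
have p : 0 < 1 + s ^+ 2 by rewrite ltr_pwDl // sqr_ge0.
have -> : eps = (1 - s ^+ 2) / (1 + s ^+ 2).
  by apply: (mulIf (lt0r_neq0 p)); rewrite divfK ?lt0r_neq0 //; lra.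
rewrite mulrAC ler_pdivlMr //.
have : 0 <= (1 - s) * s by nra.
nra.
Qed.

Lemma delta_cvg0 : delta (eps : R) @[eps --> 0^'+] --> (0 : R).
Proof.
apply: (@squeeze_cvgr _ _ _ _ (fun=> 0) id); last 2 first.
- exact: cvg_cst.
- exact: cvg_at_right_filter.
near=> eps; apply: delta_bounds; apply/andP; split; first exact: ltW.
by near: eps; apply: nbhs_right_lt.
Unshelve. all: by end_near. Qed.

End Delta.

(** * Approximately orthogonality-preserving operators *)

Section ApproximateOrthogonality.
Variables (R : realType) (H : completeNormedModType R[i]).
Variable dot : {dot H for Num.conj}.
Hypothesis dot_norm : forall x : H, dot x x = `|x| ^+ 2.
Implicit Types (x y : H) (eps : R).

(** Multiplying [x] by the conjugate of [dot x y] makes the product real, which reduces to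
    [rdot_le]. *)
Lemma dot_le x y : `|dot x y| <= `|x| * `|y|.
Proof.
have [->|d0] := eqVneq (dot x y) 0; first by rewrite normr0 mulr_ge0.
pose n := complex.Re `|dot x y|.
have nE : `|dot x y| = n%:C by rewrite RRe_real // realE normr_ge0.
have n0 : 0 < n by rewrite -ltcR -nE normr_gt0.
have := rdot_le dot_norm ((dot x y)^*%C *: x) y.
have -> : rdot dot ((dot x y)^*%C *: x) y = n ^+ 2.
  by rewrite /rdot linearZl_LR /= mulrC -sqr_normc nE -rmorphXn.
rewrite nrmZ normcJ -/n expr2 -mulrA ler_pM2l // => h.
by rewrite nE !nrmE -rmorphM lecR.
Qed.

Lemma eps_hat_ge0 (T : {linear H -> H}) : 0 <= eps_hat dot T.
Proof.
apply: lb_le_inf => [|eps [/andP[]] //].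
exists 1; split; first by rewrite ler01 lexx.
by move=> x y _; rewrite mul1r dot_le.
Qed.

(** The infimum is attained: for fixed orthogonal [x] and [y] the condition on [eps] is a closed
    inequality n <= eps K. *)
Lemma AOP_eps_hat (T : {linear H -> H}) : AOP dot (eps_hat dot T) T.
Proof.
move=> x y xy.
pose n := complex.Re `|dot (T x) (T y)|.
have nE : `|dot (T x) (T y)| = n%:C by rewrite RRe_real // realE normr_ge0.
pose K := nrm (T x) * nrm (T y).
have K0 : 0 <= K by rewrite mulr_ge0 ?nrm_ge0.
have hK eps : AOP dot eps T -> n <= eps * K.
  by move=> /(_ _ _ xy); rewrite nE !nrmE -!rmorphM lecR mulrA.
have one : AOP dot 1 T by move=> u v _; rewrite mul1r dot_le.
rewrite nE !nrmE -!rmorphM lecR -mulrA -/K.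
have [k0|k0] := leP K 0.
  have -> : K = 0 by lra.
  by have := hK _ one; lra.
rewrite -ler_pdivrMr //; apply: lb_le_inf.
  by exists 1; split => //; rewrite ler01 lexx.
by move=> eps [_ /hK]; rewrite ler_pdivrMr.
Qed.

(** The exact value of [opnorm S] is kept because it determines the minimum in the theorem. *)
Lemma conformal_approximation eps (T : {linear H -> H}) : dim_ge2 H ->
  0 <= eps < 1 -> bounded_op T -> AOP dot eps T ->
  let s := Num.sqrt ((1 - eps) / (1 + eps)) in
  exists S : {linear H -> H},
    [/\ bounded_op S, orthogonality_preserving dot S,
        opnorm (T \- S) <= (1 - s) / 2 * opnorm T &
        opnorm S = (1 + s) / 2 * opnorm T].
Proof.
move=> dimH e01 bT aT s.
have e0 : 0 <= eps by case/andP: e01.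
have s01 : 0 < s <= 1 by exact: ratio_sqrt_gt0_le1.
have /andP[s0 s1] := s01.
have s2 : s ^+ 2 * (1 + eps) = 1 - eps.
  by rewrite sqr_sqrtr ?divr_ge0 ?divfK ?gt_eqF //; lra.
have Hn0 : exists x : H, x != 0.
  have [u [v uv]] := dimH; exists u; apply/eqP => u0.
  have [//|/eqP] := uv 1 0; first by rewrite u0 scaler0 scale0r addr0.
  by rewrite oner_eq0.
set b := opnorm T.
have hT x : nrm (T x) <= b * nrm x by exact: nrm_le_opnorm.
have [b0|b0] := leP b 0.
  have bE : b = 0 by apply/eqP; rewrite eq_le b0 opnorm_ge0.
  have T0 x : T x = 0.
    by apply: nrm0_eq0; apply: le_trans (hT x) _; rewrite bE mul0r.
  exists T; split => //; last by rewrite bE mulr0.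
    by move=> x y _; rewrite T0 linear0l.
  rewrite bE mulr0; apply: opnorm_le => // x.
  by rewrite /= subrr nrm0 mul0r.
have Th y : s * b * nrm y <= nrm (T y).
  have [y0|y0] := leP (nrm y) 0.
    by rewrite (nrm0_eq0 y0) linear0 nrm0 mulr0.
  (* Read as a bound on b = |T|: every [x] is compared with the multiple of [y] of norm |x|, then
     the supremum is taken. *)
  rewrite -mulrA mulrCA -ler_pdivlMr ?mulr_gt0 //.
  apply: opnorm_le => [|x]; first by rewrite divr_ge0 ?nrm_ge0 // mulr_ge0 ?ltW.
  have nxy : nrm x = nrm ((nrm x / nrm y)%:C *: y).
    by rewrite nrmZr ger0_norm ?divr_ge0 ?nrm_ge0 // divfK // gt_eqF.
  have := AOP_nrm_le dot_norm e0 aT nxy.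
  rewrite (linearZ_LR T) /= nrmZr ger0_norm ?divr_ge0 ?nrm_ge0 // -s2 => h.
  rewrite mulrAC ler_pdivlMr ?mulr_gt0 //.
  rewrite -(@ler_pXn2r _ 2) ?nnegrE ?mulr_ge0 ?nrm_ge0 ?(ltW s0) //.
  have {}h : s ^+ 2 * nrm (T x) ^+ 2 <= (nrm x / nrm y * nrm (T y)) ^+ 2.
    by rewrite -(@ler_pM2l _ (1 + eps)) ?mulrA ?(mulrC (1 + eps)) //; lra.
  have := ler_wpM2r (sqr_ge0 (nrm y)) h; rewrite -!exprMn.
  have -> : nrm x / nrm y * nrm (T y) * nrm y = nrm (T y) * nrm x.
    by field; rewrite gt_eqF.
  by rewrite mulrA (mulrC (nrm _) s).
have [S [SS TS]] := nearest_conformal dot_norm b0 s01 hT Th.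
pose k := (1 + s) / 2 * b.
have k0 : 0 <= k by rewrite mulr_ge0 ?(ltW b0) //; lra.
have nS x : nrm (S x) = k * nrm x.
  apply/eqP; rewrite -(@eqrXn2 _ 2) ?(mulr_ge0 k0) ?nrm_ge0 //.
  by rewrite exprMn -!(rdotxx dot_norm) SS.
exists S; split.
- by apply/bounded_opP; exists k => // x; rewrite nS.
(* Both real and imaginary parts of [dot (S x) (S y)] are multiples of those of [dot x y]. *)
- move=> x y xy; rewrite dot_rdot -(linearZ_LR S) /= !SS /rdot linearZr_LR.
  by rewrite /= xy !mulr0.
- by apply: opnorm_le => [|x]; [rewrite mulr_ge0 ?(ltW b0) //; lra | exact: TS].
- exact: opnorm_conformal.
Qed.

End ApproximateOrthogonality.

Theorem mainTheorem3 (R : realType) (H : completeNormedModType R[i])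
    (dot : {dot H for Num.conj}) (dot_norm : forall x : H, dot x x = `|x| ^+ 2)
    (dimH : dim_ge2 H) :
  [/\ (forall eps : R, 0 <= eps < 1 -> 0 <= delta eps),
      delta (eps : R) @[eps --> 0^'+] --> (0 : R),
      (forall (eps : R) (T : {linear H -> H}),
         0 <= eps < 1 -> bounded_op T -> AOP dot eps T ->
         exists S : {linear H -> H},
           [/\ bounded_op S, orthogonality_preserving dot S &
               opnorm (T \- S) <= delta eps * Num.min (opnorm T) (opnorm S)])
    & (forall T : {linear H -> H},
         bounded_op T -> eps_hat dot T < 1 ->
         exists S : {linear H -> H},
           [/\ bounded_op S, orthogonality_preserving dot S,
               opnorm (T \- S)
                 <= delta (eps_hat dot T) * Num.min (opnorm T) (opnorm S) &
               delta (eps_hat dot T) * Num.min (opnorm T) (opnorm S)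
                 = (1 - Num.sqrt ((1 - eps_hat dot T) / (1 + eps_hat dot T))) / 2
                   * opnorm T])].
Proof.
(* As (1 + s) / 2 <= 1, the minimum is [y], and the factor 1 + s cancels against the denominator of
   [delta]. *)
have delta_min eps (x y : R) : 0 <= eps < 1 -> 0 <= x ->
    let s := Num.sqrt ((1 - eps) / (1 + eps)) in
    y = (1 + s) / 2 * x -> delta eps * Num.min x y = (1 - s) / 2 * x.
  move=> e01 x0 s ->; have := ratio_sqrt_gt0_le1 e01; rewrite -/s => /andP[s0 s1].
  rewrite min_r; last by rewrite ler_piMl //; lra.
  by rewrite /delta /= -/s; field; rewrite gt_eqF //; lra.
split.
- by move=> eps /delta_bounds/andP[].
- exact: delta_cvg0.
- move=> eps T e01 bT aT.
  have [S [bS oS dS nS]] := conformal_approximation dot_norm dimH e01 bT aT.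
  exists S; split => //.
  by rewrite (delta_min _ _ _ e01 (opnorm_ge0 bT) nS).
- move=> T bT e1.
  have e01 : 0 <= eps_hat dot T < 1 by rewrite eps_hat_ge0.
  have [S [bS oS dS nS]] :=
    conformal_approximation dot_norm dimH e01 bT (AOP_eps_hat dot_norm T).
  by exists S; split => //; rewrite (delta_min _ _ _ e01 (opnorm_ge0 bT) nS).
Qed.
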